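(* Let $P$ be a probability measure on $\mathbb{R}^p$ that is absolutely continuous with respect to the Lebesgue measure, with density $f$, and let $S=\{y\in\mathbb{R}^p:f(y)>0\}$. Suppose that for some $\tau>0$ and $\mu\in S$, $f$ has continuous first order partial derivatives in $\overline{B}_\tau(\mu)=\{x\in\mathbb{R}^p:\|x-\mu\|\le\tau\}$. Then $\mu$ is a stationary point for $f_\tau$ (that is, $\nabla f_\tau(\mu)=0$) if and only if $$\int_{Z_1(0)}\nabla f(\mu+\tau x_1)\,f(\mu+\tau x_2)\,dx_1dx_2=0,$$ where the integral of a vector is the vector of the integrals. Furthermore, if $f$ is $\tau$-centrally symmetric about $\mu$, then $\nabla f_\tau(\mu)=0$.
   Context: $p\ge 1$; $\|\cdot\|$ is the Euclidean norm on $\mathbb{R}^p$. For $x\in\mathbb{R}^p$ and $\tau\in[0,\infty]$, $$Z_\tau(x)=\{(x_1,x_2)\in\mathbb{R}^p\times\mathbb{R}^p:\ \max_{i=1,2}\|x-x_i\|\le\|x_1-x_2\|\le\tau\}.$$ The local lens depth is $LLD(x,\tau)=\int_{\mathbb{R}^p\times\mathbb{R}^p}\mathbf{I}((x_1,x_2)\in Z_\tau(x))\,dP(x_1)\,dP(x_2)$. $\Lambda_1$ is the Lebesgue measure of $Z_1(0)$ in $\mathbb{R}^p\times\mathbb{R}^p$. For $0<\tau<\infty$, $f_\tau(x)=\frac{1}{\tau^p\sqrt{\Lambda_1}}\sqrt{LLD(x,\tau)}$. The density $f$ is $\tau$-centrally symmetric about $\mu\in S$ if $f(\mu+x)=f(\mu-x)$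 for all $x\in\mathbb{R}^p$ with $\|x\|\le\tau$. Having continuous partial derivatives in a closed ball means having them on some open set containing that ball. *)

(* Defs.v *)
From HB Require Import structures.
From mathcomp Require Import all_boot all_order all_algebra.
From mathcomp Require Import all_classical all_reals all_analysis measurable_realfun.

Set Implicit Arguments.
Unset Strict Implicit.
Unset Printing Implicit Defensive.
Import Order.TTheory GRing.Theory Num.Theory.
Import numFieldNormedType.Exports.

Local Open Scope classical_set_scope.
Local Open Scope ring_scope.

(* R^n is 'rV[R]_n. Its sigma-algebra is the one generated by the coordinates,
   i.e. the Borel sigma-algebra (see measurable_rV_open). *)
Definition measure_rV_display : measure_display.
Proof. exact: default_measure_display. Qed.

Section measurable_rV.
Context (R : realType) (n : nat).

Let coors : 'I_n -> 'rV[R]_n -> R := fun i x => x ord0 i.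

Let rV_set0 : g_sigma_preimage coors set0.
Proof. exact: sigma_algebra0. Qed.

Let rV_setC A : g_sigma_preimage coors A -> g_sigma_preimage coors (~` A).
Proof. exact: sigma_algebraC. Qed.

Let rV_bigcup (F : (set 'rV[R]_n)^nat) :
  (forall i, g_sigma_preimage coors (F i)) ->
  g_sigma_preimage coors (\bigcup_i (F i)).
Proof. exact: sigma_algebra_bigcup. Qed.

HB.instance Definition _ := @isMeasurable.Build measure_rV_display
  'rV[R]_n (g_sigma_preimage coors) rV_set0 rV_setC rV_bigcup.

End measurable_rV.

Lemma measurable_rV_coord (R : realType) n (i : 'I_n) :
  measurable_fun [set: 'rV[R]_n]
    (fun x : 'rV[R]_n => x ord0 i).
Proof.
move=> _ Y mY; rewrite setTI; apply: sub_sigma_algebra => /=.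
rewrite -bigcup_seq/=; exists i => /=; first by rewrite mem_index_enum.
by exists Y => //; rewrite setTI.
Qed.

Lemma measurable_fun_rVP (R : realType) d (T : measurableType d) n
    (f : T -> 'rV[R]_n) :
  measurable_fun setT f <->
  forall i, measurable_fun setT (fun t => f t ord0 i).
Proof.
split=> [mf i|mf].
  exact: (measurableT_comp (measurable_rV_coord i) mf).
move=> _; rewrite -[X in forall Y, X Y -> _]/(g_sigma_preimage _).
have /= H := @g_sigma_preimage_comp _ R n
  'rV[R]_n (fun i (x : 'rV[R]_n) => x ord0 i) _ f.
suff : g_sigma_preimage
    (fun i (t : T) => f t ord0 i) `<=` measurable.
  move=> sub Y mY; apply: sub.
  have -> : g_sigma_preimage (fun i (t : T) => f t ord0 i)
    = g_sigma_preimage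
       (fun i => (fun x : 'rV[R]_n => x ord0 i) \o f) by [].
  by rewrite H; exists Y.
apply: smallest_sub; first exact: sigma_algebra_measurable.
move=> A; rewrite -bigcup_seq => -[i _ [B mB <-]].
exact: mf.
Qed.

Lemma measurable_rV_open (R : realType) n (U : set 'rV[R]_n) :
  open U -> measurable U.
Proof.
move=> oU.
pose C (q : 'rV[rat]_n * nat) : set 'rV[R]_n :=
  \bigcap_i [set x | ball (ratr (q.1 ord0 i) : R) q.2.+1%:R^-1 (x ord0 i)].
have mC q : measurable (C q).
  apply: fin_bigcap_measurable => // i _.
  rewrite -[X in measurable X]setTI.
  exact: (@measurable_rV_coord R n i measurableT _ (measurable_ball _ _)).
pose D q := if pselect (C q `<=` U) then C q else set0.
suff -> : U = \bigcup_q D q.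
  apply: countable_bigcupT_measurable => [|q]; first exact: countableP.
  by rewrite /D; case: pselect => CU; [exact: mC|exact: measurable0].
apply/seteqP; split=> [x Ux|x [q _]]; last first.
  by rewrite /D; case: pselect => // CU /CU.
have /nbhs_ballP[e /= e0 eU] := open_nbhs_nbhs (conj oU Ux).
have [k] := ltr_add_invr (divr_gt0 e0 (ltr0Sn R 1)); rewrite add0r => ke.
have /choice[r rP] (i : 'I_n) : exists r : rat,
    ball (x ord0 i) k.+1%:R^-1 (ratr r : R).
  have k0 : 0 < k.+1%:R^-1 :> R by rewrite invr_gt0.
  have xx : ball (x ord0 i) (k.+1%:R^-1 : R) !=set0.
    by exists (x ord0 i); exact: ballxx.
  by have [y [xy [r _ rE]]] := dense_rat xx (ball_open _ _); exists r; rewrite rE.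
exists (\row_i r i, k) => //; rewrite /D; case: pselect => [CU|[]].
  by move=> i _ /=; rewrite mxE; exact/ball_sym.
move=> y Cy; apply: eU; split=> // i j; rewrite (ord1 i).
have := Cy j I; rewrite /= mxE => yr.
apply: (@ball_split R R (ratr (r j))).
  exact: le_ball (ltW ke) _ (rP j).
exact: le_ball (ltW ke) _ yr.
Qed.

Definition rV_cons (R : realType) n (x : measurableTypeR R * 'rV[R]_n) :
  'rV[R]_n.+1 := \row_i oapp (x.2 ord0) x.1 (unlift ord0 i).

Definition rV_uncons (R : realType) n (v : 'rV[R]_n.+1) :
  measurableTypeR R * 'rV[R]_n :=
  (v ord0 ord0, \row_j v ord0 (lift ord0 j)).

Lemma rV_consK (R : realType) n : cancel (@rV_cons R n) (@rV_uncons R n).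
Proof.
case=> x v; rewrite /rV_uncons mxE unlift_none; congr pair.
by apply/rowP => j; rewrite !mxE liftK.
Qed.

Lemma rV_unconsK (R : realType) n : cancel (@rV_uncons R n) (@rV_cons R n).
Proof.
move=> v; apply/rowP => i; rewrite mxE.
by case: unliftP => [j|] -> //=; rewrite mxE.
Qed.

Lemma measurable_rV_cons (R : realType) n : measurable_fun setT (@rV_cons R n).
Proof.
apply/measurable_fun_rVP => i; under eq_fun do rewrite mxE.
case: unliftP => [j _|_] /=; last exact: measurable_fst.
exact: (measurableT_comp (measurable_rV_coord j) measurable_snd).
Qed.

Lemma measurable_rV_uncons (R : realType) n :
  measurable_fun setT (@rV_uncons R n).
Proof.
apply/measurable_fun_pairP; split; first exact: measurable_rV_coord.
apply/measurable_fun_rVP => i; under eq_fun do rewrite /= mxE.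
exact: measurable_rV_coord.
Qed.

Section lebesgue_rV_succ.
Local Open Scope ereal_scope.
Context (R : realType) (n : nat).
Variable m : {sigma_finite_measure set 'rV[R]_n -> \bar R}.

Definition lebesgue_rV_succ : set 'rV[R]_n.+1 -> \bar R :=
  pushforward (lebesgue_measure \x m) (@rV_cons R n).

Let mu0 : lebesgue_rV_succ set0 = 0.
Proof. by rewrite /lebesgue_rV_succ /pushforward preimage_set0 measure0. Qed.

Let mu_ge0 A : 0 <= lebesgue_rV_succ A.
Proof. by rewrite /lebesgue_rV_succ /pushforward measure_ge0. Qed.

Let mu_sigma_additive : semi_sigma_additive lebesgue_rV_succ.
Proof.
have mc := @measurable_rV_cons R n.
move=> F mF tF mUF; rewrite /lebesgue_rV_succ /pushforward preimage_bigcup.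
apply: measure_semi_sigma_additive.
- by move=> i; rewrite -[X in measurable X]setTI; exact: mc.
- apply/trivIsetP => /= i j _ _ ij; rewrite -preimage_setI.
  by move/trivIsetP : tF => /(_ _ _ _ _ ij) ->//; rewrite preimage_set0.
- by rewrite -preimage_bigcup -[X in measurable X]setTI; exact: mc.
Qed.

HB.instance Definition _ := isMeasure.Build _ _ _ lebesgue_rV_succ
  mu0 mu_ge0 mu_sigma_additive.

Let mu_sigma_finite : sigma_finite setT lebesgue_rV_succ.
Proof.
have /sigma_finiteP[F [TF ndF Foo]] := sigma_finiteT (@lebesgue_measure R).
have /sigma_finiteP[G [TG ndG Goo]] := sigma_finiteT m.
exists (fun i => @rV_uncons R n @^-1` (F i `*` G i)).
  apply/esym; rewrite -subTset => v _.
  have [i _ Fi] : (\bigcup_i F i) (@rV_uncons R n v).1 by rewrite -TF.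
  have [j _ Gj] : (\bigcup_i G i) (@rV_uncons R n v).2 by rewrite -TG.
  exists (maxn i j) => //; split.
    by move: Fi; exact/subsetPset/ndF/leq_maxl.
  by move: Gj; exact/subsetPset/ndG/leq_maxr.
move=> i; have [mF Fi] := Foo i; have [mG Gi] := Goo i; split.
  rewrite -[X in measurable X]setTI; apply: measurable_rV_uncons => //.
  exact: measurableX.
rewrite /lebesgue_rV_succ /pushforward -comp_preimage.
rewrite (_ : _ \o _ = id); last by apply/funext => x; exact: rV_consK.
rewrite preimage_id [ltLHS]product_measure1E// lte_mul_pinfty//.
by rewrite ge0_fin_numE.
Qed.

HB.instance Definition _ := Measure_isSigmaFinite.Build _ _ _ lebesgue_rV_succ
  mu_sigma_finite.

End lebesgue_rV_succ.

(* n-fold product of the Lebesgue measure on R (see lebesgue_rV_box) *)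
Fixpoint lebesgue_rV (R : realType) n :
    {sigma_finite_measure set 'rV[R]_n -> \bar R} :=
  if n is n'.+1 then lebesgue_rV_succ (lebesgue_rV R n')
  else \d_(0 : 'rV[R]_0).

Lemma lebesgue_rV_box (R : realType) n (A : 'I_n -> set (measurableTypeR R)) :
  (forall i, measurable (A i)) ->
  lebesgue_rV R n [set v | forall i, A i (v ord0 i)] =
  (\prod_i lebesgue_measure (A i))%E.
Proof.
elim: n A => [|n IH] A mA.
  by rewrite big_ord0 /= diracE mem_set// => -[].
have mB : measurable [set v : 'rV[R]_n | forall i, A (lift ord0 i) (v ord0 i)].
  rewrite (_ : mkset _ =
      \bigcap_i [set v : 'rV[R]_n | A (lift ord0 i) (v ord0 i)]); last first.
    by apply/seteqP; split=> v /= vA i; [move=> _; exact: vA|exact: vA].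
  apply: fin_bigcap_measurable => // i _; rewrite -[X in measurable X]setTI.
  exact: (@measurable_rV_coord R n i measurableT _ (mA _)).
rewrite big_ord_recl -(IH (fun i => A (lift ord0 i)))//.
rewrite -(product_measure1E lebesgue_measure (lebesgue_rV R n))//.
rewrite /= /lebesgue_rV_succ /pushforward; congr (product_measure1 _ _ _).
apply/seteqP; split=> -[x v] /=.
  move=> H; split=> [|i].
    by have := H ord0; rewrite mxE unlift_none.
  by have := H (lift ord0 i); rewrite mxE liftK.
by move=> [H0 H1] i; rewrite mxE; case: unliftP => [j|] ->.
Qed.

Section local_lens_depth.
Context (R : realType) (p : nat).
Implicit Types (x mu : 'rV[R]_p) (f : 'rV[R]_p -> R).

Definition enorm x : R := Num.sqrt (\sum_i x ord0 i ^+ 2).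

Definition lens (tau : \bar R) x : set ('rV[R]_p * 'rV[R]_p) :=
  [set z | Num.max (enorm (x - z.1)) (enorm (x - z.2)) <= enorm (z.1 - z.2) /\
           ((enorm (z.1 - z.2))%:E <= tau)%E].

Definition local_lens_depth (P : probability 'rV[R]_p R) x (tau : \bar R) : R :=
  \int[(P \x P)%E]_z (\1_(lens tau x) z).

Definition lens_volume : R :=
  fine ((lebesgue_rV R p \x lebesgue_rV R p)%E (lens 1%E 0)).

Definition f_tau (P : probability 'rV[R]_p R) (tau : R) x : R :=
  (tau ^+ p * Num.sqrt lens_volume)^-1 *
  Num.sqrt (local_lens_depth P x tau%:E).

Definition is_density (P : probability 'rV[R]_p R) f : Prop :=
  [/\ measurable_fun setT f, forall x, 0 <= f x &
      forall A, measurable A ->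
        P A = (\int[lebesgue_rV R p]_(x in A) (f x)%:E)%E].

Definition positivity_set f : set 'rV[R]_p := [set y | 0 < f y].

Definition eball (tau : R) mu : set 'rV[R]_p :=
  [set x | enorm (x - mu) <= tau].

Definition partial i f x : R := 'D_(delta_mx ord0 i) f x.

Definition has_partial i f x : Prop := derivable f x (delta_mx ord0 i).

Definition grad f x : 'rV[R]_p := \row_i partial i f x.

Definition continuous_partials_on (A : set 'rV[R]_p) f : Prop :=
  exists U : set 'rV[R]_p, [/\ open U, A `<=` U &
    forall i x, U x -> has_partial i f x /\ {for x, continuous (partial i f)}].

(* 'D_v is total, so the existence of the partial derivatives is required. *)
Definition stationary_point f x : Prop :=
  (forall i, has_partial i f x) /\ grad f x = 0.

Definition centrally_symmetric (tau : R) mu f : Prop :=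
  forall x, enorm x <= tau -> f (mu + x) = f (mu - x).

Definition vec_integral d (T : measurableType d)
    (m : {measure set T -> \bar R}) (D : set T) (g : T -> 'rV[R]_p) : 'rV[R]_p :=
  \row_i \int[m]_(z in D) g z ord0 i.

End local_lens_depth.

(* Main.v *)
Require Import Defs.
From HB Require Import structures.
From mathcomp Require Import all_boot all_order all_algebra.
From mathcomp Require Import all_classical all_reals all_analysis.
From mathcomp Require Import measurable_realfun charge ring lra.
Import Order.TTheory GRing.Theory Num.Theory.
Import numFieldNormedType.Exports.
Local Open Scope classical_set_scope.
Local Open Scope ring_scope.
Set Implicit Arguments.
Unset Strict Implicit.
Unset Printing Implicit Defensive.

(** Write [L] for the unit lens [lens 1 0].  The substitution
    [x_j = x + tau z_j] maps [L] onto the lens of [x] at scale [tau], so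
    [[
      LLD(x, tau) = tau^(2p) * int_L f(x + tau z1) f(x + tau z2) dz1 dz2
    ]]
    ([local_lens_depth_density]).  All the dependence on [x] now sits in the
    integrand, over a domain of finite measure whose points satisfy
    [|z1|, |z2| <= 1].  For [x] near [mu] the points [x + tau z_j] therefore
    stay in a small neighbourhood of the compact ball of radius [tau] about
    [mu], on which [f] and its partial derivatives are bounded
    ([C1_bounded_near_compact]); this justifies differentiation under the
    integral sign.  The product rule yields two terms, which the exchange of
    [z1] and [z2] identifies, so that the [i]-th partial derivative of the
    integral at [mu] is twice the [i]-th component of the vector integral
    ([depth_integral_is_derive]).

    The square root in [f_tau] is harmless because the depth at [mu] is
    positive: [f] is continuous and positive at [mu], and [L] contains
    arbitrarily small boxes of positive measure ([orthant_box_lens]: if all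
    coordinates of [z1] are nonnegative and all those of [z2] nonpositive, then
    [z1 - z2] dominates both coordinatewise).  By the chain rule the gradient of
    [f_tau] at [mu] is a positive multiple of the vector integral
    ([partial_f_tau]), which is the claimed equivalence.

    If [f] is centrally symmetric about [mu], its partial derivatives are odd
    about [mu] on the closed ball ([centrally_symmetric_partial_odd]), so the
    integrand changes sign under the reflection [z -> - z].  This reflection
    preserves [L] and the measure, hence the integral is zero. *)

(** * Maps that scale a measure *)

Section scaling_maps.
Local Open Scope ereal_scope.

Definition scales_measure d (T : measurableType d) (R : realType)
    (m : {measure set T -> \bar R}) (phi : T -> T) (k : R) :=
  forall A, measurable A -> m (phi @^-1` A) = k%:E * m A.

(** The canonical measure structure on [pushforward m phi] depends on the
    measurability of [phi]; an abstract measure with the same values is easier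
    to feed to uniqueness theorems. *)
Lemma pushforward_measureP d1 d2 (T1 : measurableType d1)
    (T2 : measurableType d2) (R : realType)
    (m : {measure set T1 -> \bar R}) (phi : T1 -> T2) :
  measurable_fun setT phi ->
  exists pm : {measure set T2 -> \bar R}, forall A, pm A = m (phi @^-1` A).
Proof.
by move=> mphi; unshelve eexists [the measure _ _ of pushforward m phi].
Qed.

Lemma ge0_integral_scales d (T : measurableType d) (R : realType)
    (m : {measure set T -> \bar R}) (phi : T -> T) (k : R) (D : set T)
    (g : T -> \bar R) :
  (0 < k)%R -> scales_measure m phi k -> measurable_fun setT phi ->
  measurable D -> measurable_fun D g -> (forall y, D y -> 0 <= g y) ->
  \int[m]_(x in phi @^-1` D) g (phi x) = k%:E * \int[m]_(y in D) g y.
Proof.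
move=> k0 phik mphi mD mg g0.
rewrite -[LHS](@ge0_integral_pushforward _ _ _ _ _ _ mphi m D g)//; last first.
  by move=> y /[!inE]; exact: g0.
pose kn : {nonneg R} := NngNum (ltW k0).
rewrite -[k]/(kn%:num%R) -ge0_integral_mscale//.
by apply: eq_measure_integral => A mA _; exact: phik.
Qed.

(** Change of variables for integrands of arbitrary sign.  The measurability of
    [g] is only assumed on [D], which is why [g] is first extended by zero. *)
Lemma Rintegral_preserving d (T : measurableType d) (R : realType)
    (m : {measure set T -> \bar R}) (phi : T -> T) (D : set T)
    (g : T -> R) :
  scales_measure m phi 1 -> measurable_fun setT phi ->
  measurable D -> measurable_fun D g -> phi @^-1` D = D ->
  m.-integrable D (EFin \o (g \o phi)) ->
  (\int[m]_(x in D) g (phi x) = \int[m]_(y in D) g y)%R.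
Proof.
move=> phik mphi mD mg phiD ig; congr fine.
have mgD : measurable_fun setT ((EFin \o g) \_ D).
  by apply/(measurable_restrictT _ _).1 => //; exact/measurable_EFinP.
have gphiE : ((EFin \o (g \o phi)) \_ D) = ((EFin \o g) \_ D) \o phi.
  by apply/funext => x; rewrite /= !patchE -{1}phiD.
rewrite [LHS]integral_mkcond [RHS]integral_mkcond.
transitivity (\int[pushforward m phi]_y (((EFin \o g) \_ D) y)).
  rewrite (@integral_pushforward _ _ _ _ _ _ mphi m setT _ mgD)//.
    by rewrite preimage_setT -gphiE.
  by rewrite preimage_setT -gphiE; apply/(integrable_mkcond _ mD).
apply: eq_measure_integral => A mA _.
by rewrite [LHS]phik// mul1e.
Qed.

(** The rescaled image of [m1 \x m2] agrees with [m1 \x m2] on measurable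
    rectangles, and these determine a product of sigma-finite measures. *)
Lemma scales_measure_prod d1 d2 (T1 : measurableType d1)
    (T2 : measurableType d2) (R : realType)
    (m1 : {sigma_finite_measure set T1 -> \bar R})
    (m2 : {sigma_finite_measure set T2 -> \bar R})
    (phi1 : T1 -> T1) (phi2 : T2 -> T2) (k1 k2 : R) :
  (0 < k1)%R -> (0 < k2)%R ->
  measurable_fun setT phi1 -> measurable_fun setT phi2 ->
  scales_measure m1 phi1 k1 -> scales_measure m2 phi2 k2 ->
  scales_measure (m1 \x m2) (fun z => (phi1 z.1, phi2 z.2)) (k1 * k2).
Proof.
move=> k10 k20 mphi1 mphi2 phi1k phi2k X mX.
have k0 : (0 < k1 * k2)%R by rewrite mulr_gt0.
pose phi (z : T1 * T2) := (phi1 z.1, phi2 z.2).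
have mphi : measurable_fun setT phi.
  by apply/measurable_fun_pairP; split;
    [exact: (measurableT_comp mphi1 measurable_fst)
    |exact: (measurableT_comp mphi2 measurable_snd)].
have ki0 : (0 < (k1 * k2)^-1)%R by rewrite invr_gt0.
pose kn : {nonneg R} := NngNum (ltW ki0).
have [pm pmE] : exists pm : {measure set (T1 * T2) -> \bar R},
    forall A, pm A = (m1 \x m2) (phi @^-1` A) by exact: pushforward_measureP.
transitivity ((k1 * k2)%:E * mscale kn pm X).
  rewrite /mscale/= pmE muleA -EFinM mulfV ?mul1e ?gt_eqF//.
congr (_ * _); apply/esym/product_measure_unique => // A B mA mB.
transitivity (((k1 * k2)^-1)%:E * pm (A `*` B)) => //; rewrite pmE.
have -> : phi @^-1` (A `*` B) = (phi1 @^-1` A) `*` (phi2 @^-1` B) by [].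
have mp1 : measurable (phi1 @^-1` A).
  by rewrite -[X in measurable X]setTI; exact: mphi1.
have mp2 : measurable (phi2 @^-1` B).
  by rewrite -[X in measurable X]setTI; exact: mphi2.
rewrite product_measure1E//= phi1k// phi2k//.
have cancel_k (u v : \bar R) :
    ((k1 * k2)^-1)%:E * ((k1%:E * u) * (k2%:E * v)) = u * v.
  by rewrite [X in _ * X]muleACA -EFinM [LHS]muleA -EFinM mulVf ?mul1e ?gt_eqF.
exact: cancel_k.
Qed.

Lemma scales_measure_swap d (T : measurableType d) (R : realType)
    (m : {sigma_finite_measure set T -> \bar R}) :
  scales_measure (m \x m) (fun z => (z.2, z.1)) 1.
Proof.
move=> X mX; rewrite mul1e.
pose sw (z : T * T) := (z.2, z.1).
have mswap : measurable_fun setT sw by exact: measurable_swap.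
have [pm pmE] : exists pm : {measure set (T * T) -> \bar R},
    forall A, pm A = (m \x m) (sw @^-1` A) by exact: pushforward_measureP.
transitivity (pm X); first by rewrite pmE.
apply/esym/product_measure_unique => // A B mA mB.
rewrite pmE.
have -> : sw @^-1` (A `*` B) = B `*` A.
  by apply/seteqP; split=> -[x y] [].
by rewrite product_measure1E//= muleC.
Qed.

(** It suffices to compare half-open intervals; the preimage of such an interval
    is closed on the left instead of on the right when [c] is negative. *)
Lemma scales_lebesgue_affine (R : realType) (a c : R) : c != 0%R ->
  scales_measure (@lebesgue_measure R)
    (fun y : measurableTypeR R => (a + c * y)%R : measurableTypeR R) `|c|^-1.
Proof.
move=> c0 X mX.
pose phi (y : measurableTypeR R) : measurableTypeR R := (a + c * y)%R.
have mphi : measurable_fun setT phi.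
  by apply: measurable_funD => //; exact: measurable_funM.
have nc0 : (0 < `|c|)%R by rewrite normr_gt0.
pose kn : {nonneg R} := NngNum (ltW nc0).
have [pm pmE] : exists pm : {measure set (measurableTypeR R) -> \bar R},
    forall A, pm A = lebesgue_measure (phi @^-1` A) by exact: pushforward_measureP.
transitivity (`|c|^-1%:E * mscale kn pm X).
  by rewrite /mscale/= pmE muleA -EFinM mulVf ?mul1e ?gt_eqF//.
congr (_ * _); apply/esym/lebesgue_measure_unique => // _ [[u v]] _ <-.
transitivity (`|c|%:E * pm `]u, v]%classic) => //.
rewrite pmE lebesgue_measure_itv/=.
have [cgt0|clt0] : (0 < c \/ c < 0)%R.
  by move: c0; rewrite neq_lt => /orP[]; auto.
  have -> : phi @^-1` `]u, v] = `]((u - a) / c)%R, ((v - a) / c)%R]%classic.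
    apply/seteqP; split=> y /=; rewrite !in_itv/= /phi;
    rewrite ltr_pdivrMr// ler_pdivlMr//;
    by rewrite ltrBlDr lerBrDr ![(a + _)%R]addrC (mulrC y).
  rewrite lebesgue_measure_itv/= !lte_fin ltr_pM2r ?invr_gt0// ltrD2r.
  case: ifPn => _; last by rewrite mule0.
  by rewrite -!EFinB -EFinM gtr0_norm//; congr EFin; field.
have -> : phi @^-1` `]u, v] = `[((v - a) / c)%R, ((u - a) / c)%R[%classic.
  apply/seteqP; split=> y /=; rewrite !in_itv/= /phi;
  rewrite ler_ndivrMr// ltr_ndivlMr//;
  by rewrite ltrBlDr lerBrDr ![(a + _)%R]addrC (mulrC y) andbC.
rewrite lebesgue_measure_itv/= !lte_fin ltr_nM2r ?invr_lt0// ltrD2r.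
case: ifPn => _; last by rewrite mule0.
by rewrite -!EFinB -EFinM ltr0_norm//; congr EFin; field.
Qed.
End scaling_maps.

Section lebesgue_rV_affine.
Variable R : realType.

Lemma measurable_affine_rV n (a : 'rV[R]_n) (c : R) :
  measurable_fun setT (fun y : 'rV[R]_n => a + c *: y).
Proof.
apply/measurable_fun_rVP => i; under eq_fun do rewrite !mxE.
apply: measurable_funD => //; apply: measurable_funM => //.
exact: measurable_rV_coord.
Qed.

(** [lebesgue_rV R n.+1] is the image of a product measure under [rV_cons],
    which conjugates the affine map in dimension [n.+1] to the product of the
    one-dimensional one and the one in dimension [n]. *)
Lemma scales_lebesgue_rV n (a : 'rV[R]_n) (c : R) : c != 0 ->
  scales_measure (lebesgue_rV R n) (fun y => a + c *: y) (`|c|^-1 ^+ n).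
Proof.
move=> c0; elim: n a => [|n IH] a A mA.
  rewrite expr0 mul1e; congr (lebesgue_rV R 0 _).
  by apply/seteqP; split=> y /=; congr A; apply/rowP => -[].
pose psi (z : measurableTypeR R * 'rV[R]_n) : measurableTypeR R * 'rV[R]_n :=
  (a ord0 ord0 + c * z.1, (rV_uncons a).2 + c *: z.2).
have nc0 : 0 < `|c|^-1 by rewrite invr_gt0 normr_gt0.
have := @scales_measure_prod _ _ _ _ _ (@lebesgue_measure R) (lebesgue_rV R n)
  (fun y => a ord0 ord0 + c * y) (fun y => (rV_uncons a).2 + c *: y)
  `|c|^-1 (`|c|^-1 ^+ n) nc0 (exprn_gt0 _ nc0).
move=> /(_ _ _ (scales_lebesgue_affine _ c0) (IH _)) H.
have mcA : measurable (@rV_cons R n @^-1` A).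
  by rewrite -[X in measurable X]setTI; exact: measurable_rV_cons.
rewrite exprS; move: H => /(_ _ _ _ mcA) H.
rewrite -[RHS]H; last 2 first.
- by apply: measurable_funD => //; exact: measurable_funM.
- exact: measurable_affine_rV.
rewrite /= /lebesgue_rV_succ /pushforward; congr (product_measure1 _ _ _).
apply/seteqP; split => z /=; congr A; apply/rowP => i; rewrite !mxE;
by case: unliftP => [j|] -> /=; rewrite ?mxE.
Qed.
Lemma measurable_affine_pair n (a : 'rV[R]_n) (c : R) :
  measurable_fun setT
    (fun z : 'rV[R]_n * 'rV[R]_n => (a + c *: z.1, a + c *: z.2)).
Proof.
have maff := measurable_affine_rV a c.
apply/measurable_fun_pairP; split.
  exact: (measurableT_comp maff measurable_fst).
exact: (measurableT_comp maff measurable_snd).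
Qed.

Lemma scales_affine_pair n (a : 'rV[R]_n) (c : R) : c != 0 ->
  scales_measure (lebesgue_rV R n \x lebesgue_rV R n)%E
    (fun z => (a + c *: z.1, a + c *: z.2)) (`|c|^-1 ^+ n * `|c|^-1 ^+ n).
Proof.
move=> c0; have maff := measurable_affine_rV a c.
have k0 : 0 < `|c|^-1 ^+ n by rewrite exprn_gt0// invr_gt0 normr_gt0.
have affk := scales_lebesgue_rV a c0.
exact: (scales_measure_prod k0 k0 maff maff affk affk).
Qed.

End lebesgue_rV_affine.

(** * Products of measures with a density *)

Section product_density.
Local Open Scope ereal_scope.
Context d (T : measurableType d) (R : realType).
Variables (m : {sigma_finite_measure set T -> \bar R}).
Variables (P : probability T R) (f : T -> R).
Hypotheses (mf : measurable_fun setT f) (f0 : forall x, (0 <= f x)%R).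
Hypothesis Pf : forall A, measurable A -> P A = \int[m]_(x in A) (f x)%:E.

(** The right-hand side is a measure in [A]; by Tonelli it gives a rectangle
    [B `*` C] the value [P B * P C], which characterizes [P \x P]. *)
Lemma product_density A : measurable A ->
  (P \x P) A = \int[m \x m]_(z in A) (f z.1 * f z.2)%:E.
Proof.
move=> mA.
pose F (z : T * T) : \bar R := (f z.1 * f z.2)%:E.
have mF : measurable_fun setT F.
  apply/measurable_EFinP; apply: measurable_funM.
    exact: (measurableT_comp mf measurable_fst).
  exact: (measurableT_comp mf measurable_snd).
have F0 z : 0 <= F z by rewrite lee_fin mulr_ge0.
have [m' m'E] : exists m' : {measure set (T * T) -> \bar R},
    forall B, m' B = \int[m \x m]_(z in B) F z.
  pose nu B := \int[m \x m]_(z in B) F z.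
  have nu0 : nu set0 = 0 by rewrite /nu integral_set0.
  have nu_ge0 B : 0 <= nu B by exact: integral_ge0.
  have nuD : semi_sigma_additive nu by exact: semi_sigma_additive_nng_induced.
  pose nu_measure : Measure.type _ R :=
    HB.pack nu (isMeasure.Build _ _ _ nu nu0 nu_ge0 nuD).
  by exists nu_measure.
transitivity (m' A); last by rewrite m'E.
apply: product_measure_unique => // B C mB mC.
rewrite m'E integral_mkcond.
have FE : F \_ (B `*` C) = fun z => ((f \_ B) z.1)%:E * ((f \_ C) z.2)%:E.
  apply/funext => -[x y]; rewrite !patchE/= in_setX/=.
  case: (x \in B) => /=; last by rewrite mul0e.
  by case: (y \in C) => /=; rewrite ?mule0.
have mfB D : measurable D -> measurable_fun setT (EFin \o (f \_ D)).
  move=> mD; apply/measurable_EFinP/(measurable_restrictT _ mD).1.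
  exact: measurable_funTS.
have fB0 D x : 0 <= (EFin \o (f \_ D)) x.
  by rewrite /= patchE; case: ifPn => _; rewrite lee_fin.
rewrite FE fubini_tonelli1/=; last 2 first.
- apply: emeasurable_funM.
    exact: (measurableT_comp (mfB _ mB) measurable_fst).
  exact: (measurableT_comp (mfB _ mC) measurable_snd).
- by move=> z; rewrite mule_ge0//; exact: fB0.
have PE D : measurable D -> P D = \int[m]_x (EFin \o (f \_ D)) x.
  by move=> mD; rewrite Pf// integral_mkcond restrict_EFin.
transitivity (\int[m]_x ((EFin \o (f \_ B)) x * P C)).
  apply: eq_integral => x _; rewrite /fubini_F/= ge0_integralZl//.
  - by rewrite -PE.
  - exact: mfB.
  - by move=> y _; exact: fB0.
  - exact: (fB0 _ x).
rewrite (@ge0_integralZr _ _ _ m setT measurableT (EFin \o (f \_ B)))//.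
- by rewrite -PE.
- exact: mfB.
Qed.
End product_density.

(** * The Euclidean norm and the lenses *)

Lemma measurable_fun_continuous_rV (R : realType) n (U : set 'rV[R]_n)
    (g : 'rV[R]_n -> R) :
  open U -> (forall x, U x -> {for x, continuous g}) -> measurable_fun U g.
Proof.
move=> oU cg; apply: (measurability _ (RGenOpens.measurableE R)).
move=> _ [_ [a [b ->] <-]]; apply: measurable_rV_open.
rewrite openE => x [Ux gx]; apply: filterI; first exact: open_nbhs_nbhs.
by apply: (cg x Ux); apply: open_nbhs_nbhs; split => //; exact: interval_open.
Qed.

Section euclidean_norm.
Variables (R : realType) (n : nat).
Implicit Types x y : 'rV[R]_n.

Lemma sumsq_ge0 x : 0 <= \sum_i x ord0 i ^+ 2.
Proof. by apply: sumr_ge0 => i _; exact: sqr_ge0. Qed.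

Lemma le_coord_enorm x i : `|x ord0 i| <= enorm x.
Proof.
rewrite -sqrtr_sqr ler_sqrt ?sumsq_ge0// (bigD1 i)//= lerDl.
by apply: sumr_ge0 => j _; exact: sqr_ge0.
Qed.

Lemma le_enorm x y : (forall i, `|x ord0 i| <= `|y ord0 i|) ->
  enorm x <= enorm y.
Proof.
move=> xy; rewrite ler_sqrt ?sumsq_ge0//; apply: ler_sum => i _.
rewrite -(real_normK (num_real (x ord0 i))) -[leRHS](real_normK (num_real _)).
by rewrite lerXn2r ?nnegrE.
Qed.

Lemma enormZ c x : enorm (c *: x) = `|c| * enorm x.
Proof.
rewrite /enorm -sqrtr_sqr -sqrtrM ?sqr_ge0//; congr Num.sqrt.
by rewrite mulr_sumr; apply: eq_bigr => i _; rewrite mxE exprMn.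
Qed.

Lemma enormN x : enorm (- x) = enorm x.
Proof. by rewrite -scaleN1r enormZ normrN1 mul1r. Qed.

Lemma continuous_enorm : continuous (@enorm R n).
Proof.
have csum : continuous (fun x : 'rV[R]_n => \sum_i x ord0 i ^+ 2).
  apply: continuous_big => [|i _ x]; first exact: add_continuous.
  exact: (continuous_comp (@coord_continuous R 1 n ord0 i x)
    (@exprn_continuous R 2 _)).
by move=> x; exact: (continuous_comp (csum x) (@sqrt_continuous R _)).
Qed.

Lemma measurable_enorm : measurable_fun setT (@enorm R n).
Proof.
apply: measurable_fun_continuous_rV => [|x _]; first exact: openT.
exact: continuous_enorm.
Qed.

(** The norm of ['rV[R]_n] is the maximum norm, which the Euclidean norm
    dominates, so a Euclidean ball is bounded; it is closed by continuity. *)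
Lemma eball_compact (r : R) x : compact (eball r x).
Proof.
apply: bounded_closed_compact.
  exists (`|x| + r); split; first exact: num_real.
  move=> M rM y /= yx; apply: le_trans (ltW rM).
  rewrite -[y](subrK x) (le_trans (ler_normD _ _))// addrC lerD2l.
  apply: le_trans yx; rewrite {1}/Num.norm/= mx_normrE; apply/bigmax_leP; split.
    exact: sqrtr_ge0.
  by move=> [i j] _ /=; rewrite (ord1 i); exact: le_coord_enorm.
rewrite (_ : eball r x = (fun y => enorm (y - x)) @^-1` [set t | t <= r])//.
apply: preimage_closed; last exact: closed_le.
move=> y _; apply: (@continuous_comp _ _ _ (fun y => y - x) (@enorm R n)).
  apply: (@continuousB _ _ _ id (cst x)); first by move=> ?.
  exact: cst_continuous.
exact: continuous_enorm.
Qed.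

End euclidean_norm.

Section lenses.
Variables (R : realType) (p : nat).
Local Notation leb2 := (lebesgue_rV R p \x lebesgue_rV R p)%E.

Lemma measurable_lens (tau : R) (x : 'rV[R]_p) : measurable (lens tau%:E x).
Proof.
have m1 (y : 'rV[R]_p) (g : 'rV[R]_p * 'rV[R]_p -> 'rV[R]_p) :
    measurable_fun setT g -> measurable_fun setT (fun z => enorm (y - g z)).
  move=> mg; apply: (measurableT_comp (@measurable_enorm R p)).
  apply/measurable_fun_rVP => i; under eq_fun do rewrite !mxE.
  apply: measurable_funB => //.
  exact: (measurableT_comp (measurable_rV_coord i) mg).
have m2 : measurable_fun setT
    (fun z : 'rV[R]_p * 'rV[R]_p => enorm (z.1 - z.2)).
  apply: (measurableT_comp (@measurable_enorm R p)).
  apply/measurable_fun_rVP => i; under eq_fun do rewrite !mxE.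
  apply: measurable_funB.
    exact: (measurableT_comp (measurable_rV_coord i) measurable_fst).
  exact: (measurableT_comp (measurable_rV_coord i) measurable_snd).
rewrite (_ : lens _ _ =
  [set z | Num.max (enorm (x - z.1)) (enorm (x - z.2)) <= enorm (z.1 - z.2)]
  `&` [set z | enorm (z.1 - z.2) <= tau]); last first.
  by apply/seteqP; split=> z [? ?]; split.
apply: measurableI.
  rewrite -[X in measurable X]setTI; apply: measurable_fun_le => //.
  apply: measurable_maxr; apply: m1; first exact: measurable_fst.
  exact: measurable_snd.
by rewrite -[X in measurable X]setTI; exact: measurable_fun_le.
Qed.

Lemma preimage_lens (tau : R) (x : 'rV[R]_p) : 0 < tau ->
  (fun z : 'rV[R]_p * 'rV[R]_p => (x + tau *: z.1, x + tau *: z.2)) @^-1`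
    lens tau%:E x = lens 1%E 0.
Proof.
move=> tau0.
have side (y : 'rV[R]_p) : enorm (x - (x + tau *: y)) = tau * enorm (0 - y).
  by rewrite opprD addrA subrr !sub0r -scalerN enormZ gtr0_norm.
have diff (y y' : 'rV[R]_p) :
    enorm ((x + tau *: y) - (x + tau *: y')) = tau * enorm (y - y').
  by rewrite opprD addrACA subrr add0r -scalerBr enormZ gtr0_norm.
have cap t : (tau * t <= tau) = (t <= 1).
  by rewrite -[X in _ <= X]mulr1 ler_pM2l.
apply/seteqP; split=> z; rewrite /preimage /lens /=;
rewrite !side diff -maxr_pMr ?(ltW tau0)// ?lee_fin ler_pM2l//;
by rewrite ?lee_fin cap.
Qed.

Lemma lens_sub_unit (z : 'rV[R]_p * 'rV[R]_p) : lens 1%E 0 z ->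
  enorm z.1 <= 1 /\ enorm z.2 <= 1.
Proof.
rewrite /lens/= !sub0r !enormN lee_fin => -[+ z1].
by rewrite ge_max => /andP[a b]; split; exact: le_trans z1.
Qed.

(** The next two invariances are the symmetries of the domain of integration
    used below: exchange of the two points, and reflection in the origin. *)
Lemma lens_swap (z : 'rV[R]_p * 'rV[R]_p) :
  lens 1%E 0 (z.2, z.1) <-> lens 1%E 0 z.
Proof.
rewrite /lens /= (_ : enorm (z.2 - z.1) = enorm (z.1 - z.2)); last first.
  by rewrite -enormN opprB.
by rewrite maxC.
Qed.

Lemma lens_opp (z : 'rV[R]_p * 'rV[R]_p) :
  lens 1%E 0 (- z.1, - z.2) <-> lens 1%E 0 z.
Proof.
rewrite /lens /= (_ : enorm (- z.1 - - z.2) = enorm (z.1 - z.2)); last first.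
  by rewrite -opprD enormN.
by rewrite !sub0r !enormN.
Qed.

Lemma measurable_rV_box (A : 'I_p -> set (measurableTypeR R)) :
  (forall i, measurable (A i)) ->
  measurable [set v : 'rV[R]_p | forall i, A i (v ord0 i)].
Proof.
move=> mA; rewrite (_ : mkset _ =
    \bigcap_i [set v : 'rV[R]_p | A i (v ord0 i)]); last first.
  by apply/seteqP; split=> v /= vA i; [move=> _; exact: vA|exact: vA].
apply: fin_bigcap_measurable => // i _; rewrite -[X in measurable X]setTI.
exact: (@measurable_rV_coord R p i measurableT _ (mA _)).
Qed.

Lemma measurable_rV_cube (a b : R) :
  measurable [set v : 'rV[R]_p | forall i, `[a, b]%classic (v ord0 i)].
Proof. exact: (@measurable_rV_box (fun=> `[a, b]%classic)). Qed.

Lemma lebesgue_rV_cube (a b : R) : a < b ->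
  lebesgue_rV R p [set v | forall i, `[a, b]%classic (v ord0 i)] =
  ((b - a) ^+ p)%:E.
Proof.
move=> ab; rewrite (lebesgue_rV_box (A := fun=> `[a, b]%classic))//.
rewrite (eq_bigr (fun=> (b - a)%:E)); last first.
  by move=> i _; rewrite lebesgue_measure_itv/= lte_fin ab EFinB.
by rewrite prodEFin prodr_const card_ord.
Qed.

Lemma lens_finite : (leb2 (lens 1%E (0%R : 'rV[R]_p)) < +oo)%E.
Proof.
pose C := [set v : 'rV[R]_p | forall i, `[(-1), 1]%classic (v ord0 i)].
have mC : measurable C by exact: measurable_rV_cube.
apply: (@le_lt_trans _ _ (leb2 (C `*` C))).
  apply: le_measure; rewrite ?inE; [exact: measurable_lens|exact: measurableX|].
  move=> z /lens_sub_unit[z1 z2]; split=> i /=; rewrite in_itv/= -ler_norml.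
    exact: le_trans (le_coord_enorm _ _) z1.
  exact: le_trans (le_coord_enorm _ _) z2.
have Cfin : (lebesgue_rV R p C < +oo)%E.
  by rewrite lebesgue_rV_cube ?gtrN// ltry.
by rewrite /= product_measure1E// lte_mul_pinfty// ge0_fin_numE.
Qed.

(** Pairs of points in opposite orthants: for small [s] these are sets of
    positive measure inside the unit lens, shrinking to the origin. *)
Definition orthant_box (s : R) : set ('rV[R]_p * 'rV[R]_p) :=
  [set v : 'rV[R]_p | forall i, `[0, s]%classic (v ord0 i)] `*`
  [set v : 'rV[R]_p | forall i, `[(- s), 0]%classic (v ord0 i)].

Lemma measurable_orthant_box s : measurable (orthant_box s).
Proof. by apply: measurableX; exact: measurable_rV_cube. Qed.

Lemma orthant_box_gt0 (s : R) : 0 < s -> (0 < leb2 (orthant_box s))%E.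
Proof.
move=> s0; rewrite /orthant_box /= product_measure1E//;
  try exact: measurable_rV_cube.
have cube_gt0 a b : a < b ->
    (0 < lebesgue_rV R p [set v | forall i, `[a, b]%classic (v ord0 i)])%E.
  by move=> ab; rewrite lebesgue_rV_cube// lte_fin exprn_gt0// subr_gt0.
by apply: mule_gt0; apply: cube_gt0; rewrite ?oppr_lt0.
Qed.

Lemma orthant_box_coord (s : R) z : orthant_box s z ->
  forall i, `|z.1 ord0 i| <= s /\ `|z.2 ord0 i| <= s.
Proof.
move=> [z1 z2] i; have := z1 i; have := z2 i; rewrite /= !in_itv/=.
move=> /andP[a b] /andP[c d]; rewrite !ler_norml; split; apply/andP; split; lra.
Qed.

(** For a pair in opposite orthants the coordinates of [z1 - z2] are sums of
    absolute values, so [|z1|] and [|z2|] are at most [|z1 - z2|].  Each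
    coordinate of [z1 - z2] is at most [2 s <= (p + 1)^-1], whence
    [|z1 - z2|^2 <= p / (p + 1)^2 <= 1]. *)
Lemma orthant_box_lens (s : R) : 0 < s -> s <= (2 * p.+1%:R)^-1 ->
  orthant_box s `<=` lens 1%E 0.
Proof.
move=> s0 sp z [z1 z2]; rewrite /lens/= !sub0r !enormN; split.
  rewrite ge_max; apply/andP; split; apply: le_enorm => i.
    have := z1 i; have := z2 i; rewrite /= !in_itv/= !mxE.
    move=> /andP[a b] /andP[c d]; rewrite !ger0_norm; lra.
  have := z1 i; have := z2 i; rewrite /= !in_itv/= !mxE.
  move=> /andP[a b] /andP[c d]; rewrite ler0_norm// ger0_norm; lra.
rewrite lee_fin -sqrtr1 ler_sqrt//.
have p0 : 0 < p.+1%:R :> R by rewrite ltr0n.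
have s1 : 2 * s <= p.+1%:R^-1.
  by rewrite mulrC -ler_pdivlMr// mulrC -invfM.
apply: (@le_trans _ _ (\sum_(i < p) (p.+1%:R^-1 ^+ 2))).
  apply: ler_sum => i _; rewrite !mxE.
  have := z1 i; have := z2 i; rewrite /= !in_itv/= => /andP[a b] /andP[c d].
  have z0 : 0 <= z.1 ord0 i - z.2 ord0 i by lra.
  by rewrite ler_sqr ?nnegrE ?invr_ge0 ?(ltW p0)// (le_trans _ s1)//; lra.
rewrite sumr_const card_ord exprVn -[X in X <= _]mulr_natl.
rewrite ler_pdivrMr ?exprn_gt0// mul1r.
by rewrite -natrX ler_nat (leq_trans (leqnSn p))// -[leqLHS]expn1 leq_pexp2l.
Qed.

End lenses.

(** * Functions with continuous partial derivatives *)

Section directional_derivatives.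
Variable R : realType.

Lemma derivable_line (V W : normedModType R) (f : V -> W) (w v : V) (s : R) :
  derivable (fun t : R => f (w + t *: v)) s 1 <-> derivable f (w + s *: v) v.
Proof.
rewrite /derivable; set g1 := fun h => h^-1 *: _; set g2 := fun h => h^-1 *: _.
suff -> : g1 = g2 by [].
apply/funext => h; rewrite /g1 /g2 /=; congr (_ *: (f _ - _)).
by rewrite [_%:A]mulr1 scalerDl addrCA.
Qed.

Lemma derive_line (V W : normedModType R) (f : V -> W) (w v : V) (s : R) :
  'D_1 (fun t : R => f (w + t *: v)) s = 'D_v f (w + s *: v).
Proof.
rewrite /derive; set g1 := fun h => h^-1 *: _; set g2 := fun h => h^-1 *: _.
suff -> : g1 = g2 by [].
apply/funext => h; rewrite /g1 /g2 /=; congr (_ *: (f _ - _)).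
by rewrite [_%:A]mulr1 scalerDl addrCA.
Qed.

Lemma mean_value_bound (psi : R -> R) (h M : R) :
  (forall s, `|s| <= `|h| -> derivable psi s 1 /\ `|'D_1 psi s| <= M) ->
  `|psi h - psi 0| <= M * `|h|.
Proof.
move=> H.
have D a b : (forall s, s \in `[a, b] -> `|s| <= `|h|) -> a <= b ->
    `|psi b - psi a| <= M * (b - a).
  move=> sh ab.
  have [//|||c cab ->] := @MVT_segment _ psi (fun s => 'D_1 psi s) a b.
  - move=> s sab; apply/DeriveDef => //.
    by apply: (H _ _).1; apply: sh; exact: subset_itv_oo_cc.
  - by apply: derivable_within_continuous => s sab; exact: (H _ (sh _ sab)).1.
  rewrite normrM (ger0_norm (_ : 0 <= b - a)) ?subr_ge0//.
  by rewrite ler_wpM2r ?subr_ge0//; exact: (H _ (sh _ cab)).2.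
have [h0|h0] := leP 0 h.
  rewrite (ger0_norm h0) -[X in M * X]subr0; apply: D => // s.
  by rewrite in_itv/= => /andP[s0 sh]; rewrite !ger0_norm.
rewrite distrC (ltr0_norm h0) -[X in M * X]sub0r; apply: D; last exact: ltW.
move=> s; rewrite in_itv/= => /andP[hs s0].
by rewrite (ler0_norm s0) (ltr0_norm h0) lerN2.
Qed.

Variable p : nat.
Implicit Types (f : 'rV[R]_p -> R) (x y : 'rV[R]_p).

Lemma ball_rVP x r y : 0 < r ->
  ball x r y <-> (forall i, `|x ord0 i - y ord0 i| < r).
Proof.
move=> r0; split=> [[_ xy] i|xy]; first exact: xy.
by split=> // i j; rewrite (ord1 i); exact: xy.
Qed.

Lemma continuous_rV_ballP f x : {for x, continuous f} <->
  forall e, 0 < e -> exists2 d, 0 < d & forall y, ball x d y -> `|f x - f y| < e.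
Proof.
have P := @cvgrPdist_lt R R^o 'rV[R]_p (nbhs x) _ f (f x).
split=> [/P cf e e0|H].
  by have /nbhs_ballP[d d0 fd] := cf e e0; exists d.
by apply/P => e e0; apply/nbhs_ballP; have [d d0 fd] := H e e0; exists d.
Qed.

(** Move from [x] to [y] by changing one coordinate at a time; since balls are
    cubes, the path stays in the ball, and the mean value theorem bounds each
    of the [p] increments. *)
Lemma bounded_partials_lipschitz f x (r M : R) : 0 < r ->
  (forall y, ball x r y -> forall i, has_partial i f y /\ `|partial i f y| <= M) ->
  forall y, ball x r y -> `|f y - f x| <= M * \sum_i `|y ord0 i - x ord0 i|.
Proof.
move=> r0 H y xy.
(* [w k] has the first [k] coordinates of [y] and the others of [x]. *)
pose w k : 'rV[R]_p := \row_j (if (j < k)%N then y ord0 j else x ord0 j).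
have -> : f y = f (w p) by congr f; apply/rowP => j; rewrite mxE ltn_ord.
have -> : f x = f (w 0) by congr f; apply/rowP => j; rewrite mxE.
rewrite -(telescope_sumr (fun k => f (w k)))// big_mkord.
apply: (le_trans (ler_norm_sum _ _ _)); rewrite mulr_sumr; apply: ler_sum => k _.
set h := y ord0 k - x ord0 k; pose e : 'rV[R]_p := delta_mx ord0 k.
have wS : w k.+1 = w k + h *: e.
  apply/rowP => j; rewrite !mxE eqxx/= ltnS leq_eqVlt.
  have [->|jk] := eqVneq j k; first by rewrite eqxx ltnn/= mulr1 addrC subrK.
  by rewrite -val_eqE in jk; rewrite (negbTE jk)/= mulr0 addr0.
rewrite wS -{2}[w k]addr0 -(scale0r e).
apply: (mean_value_bound (psi := fun t => f (w k + t *: e))) => s sh.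
have ws : ball x r (w k + s *: e).
  apply/ball_rVP => // j; rewrite !mxE eqxx/=.
  have xyi := (ball_rVP x y r0).1 xy.
  have [->|jk] := eqVneq j k; last first.
    by rewrite mulr0 addr0; case: ifPn => _; rewrite ?subrr ?normr0// xyi.
  rewrite ltnn mulr1 opprD addrA subrr sub0r normrN (le_lt_trans sh)//.
  by rewrite distrC xyi.
by rewrite derivable_line derive_line; exact: H.
Qed.

Lemma bounded_partials_continuous f x (r M : R) : 0 < r ->
  (forall y, ball x r y -> forall i, has_partial i f y /\ `|partial i f y| <= M) ->
  {for x, continuous f}.
Proof.
move=> r0 H; have lip := bounded_partials_lipschitz r0 H.
apply/continuous_rV_ballP => e e0.
pose K := `|M| * p%:R + 1.
have K0 : 0 < K by rewrite ltr_wpDl// mulr_ge0.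
have eK0 : 0 < e / K by rewrite divr_gt0.
exists (Num.min r (e / K)); first by rewrite lt_min r0.
move=> y xy; have xyr : ball x r y by apply: le_ball xy; rewrite ge_min lexx.
have xye : ball x (e / K) y by apply: le_ball xy; rewrite ge_min lexx orbT.
rewrite distrC; apply: (le_lt_trans (lip _ xyr)).
apply: (@le_lt_trans _ _ (`|M| * \sum_(i < p) (e / K))).
  apply: (@le_trans _ _ (`|M| * \sum_i `|y ord0 i - x ord0 i|)).
    by rewrite ler_wpM2r ?ler_norm// sumr_ge0.
  rewrite ler_wpM2l//; apply: ler_sum => i _.
  by rewrite distrC ltW//; exact: ((ball_rVP x y eK0).1 xye).
rewrite sumr_const card_ord.
have -> : `|M| * (e / K *+ p) = e * (`|M| * p%:R) / K.
  by rewrite -[_ *+ p]mulr_natl; ring.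
rewrite ltr_pdivrMr//.
by rewrite ltr_pM2l// /K ltrDl.
Qed.

Section C1_on_open_set.
Variables (U : set 'rV[R]_p) (f : 'rV[R]_p -> R).
Hypothesis oU : open U.
Hypothesis C1 : forall i x, U x ->
  has_partial i f x /\ {for x, continuous (partial i f)}.

Lemma C1_partials_locally_bounded x : U x -> exists e M : R,
  0 < e /\ forall y, ball x e y -> U y /\ forall i, `|partial i f y| <= M.
Proof.
move=> Ux; pose M := \sum_j (`|partial j f x| + 1).
have : \forall y \near x, U y /\
    forall i, `|partial i f y| <= `|partial i f x| + 1.
  apply: filterI; first exact: open_nbhs_nbhs.
  apply: (@filter_forall _ _
    (fun i => [set y | `|partial i f y| <= `|partial i f x| + 1]) (nbhs x)) => j.
  apply/nbhs_ballP.
  have [d d0 xd] := (continuous_rV_ballP _ _).1 (C1 j Ux).2 1 ltr01.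
  exists d => // y /xd/ltW xy.
  by rewrite /= -lerBlDl (le_trans (lerB_dist _ _))// distrC.
move=> /nbhs_ballP[e /= e0 eU]; exists e, M; split=> // y /eU[Uy fy].
split=> // i; apply: (le_trans (fy i)).
by rewrite /M (bigD1 i)//= lerDl sumr_ge0// => j _; rewrite addr_ge0.
Qed.

(** Mere existence of partial derivatives would not suffice: continuity of [f]
    comes from their local boundedness. *)
Lemma C1_continuous x : U x -> {for x, continuous f}.
Proof.
move=> Ux; have [e [M [e0 H]]] := C1_partials_locally_bounded Ux.
apply: (bounded_partials_continuous e0) => y xy i; have [Uy fy] := H y xy.
by split; [exact: (C1 i Uy).1|exact: fy].
Qed.

Lemma C1_locally_bounded x : U x -> exists e M : R, 0 < e /\
  forall y, ball x e y ->
    [/\ U y, `|f y| <= M & forall i, `|partial i f y| <= M].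
Proof.
move=> Ux; have [e [M [e0 H]]] := C1_partials_locally_bounded Ux.
have [e' e'0 fe'] := (continuous_rV_ballP _ _).1 (C1_continuous Ux) 1 ltr01.
exists (Num.min e e'), (Num.max M (`|f x| + 1)); split.
  by rewrite lt_min e0.
move=> y xy; have [Uy fy] : U y /\ forall i, `|partial i f y| <= M.
  by apply: H; apply: le_ball xy; rewrite ge_min lexx.
split=> // [|i]; rewrite le_max ?fy//.
have /fe'/ltW xe' : ball x e' y by apply: le_ball xy; rewrite ge_min lexx orbT.
by rewrite -[X in _ || X]lerBlDl (le_trans (lerB_dist _ _)) ?orbT// distrC.
Qed.

(** The local bounds on balls about the points of [K] are made uniform by
    compactness, in the form of near-coverings: one integer [n] serves both as
    the bound and, through [n.+1%:R^-1], as the radius. *)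
Lemma C1_bounded_near_compact (K : set 'rV[R]_p) : compact K -> K `<=` U ->
  exists e M : R, 0 < e /\ forall x y, K x -> ball x e y ->
    [/\ U y, `|f y| <= M & forall i, `|partial i f y| <= M].
Proof.
move=> cK KU.
pose Q (n : nat) x := forall y, ball x (n.+1%:R^-1 : R) y ->
    [/\ U y, `|f y| <= n%:R & forall i, `|partial i f y| <= n%:R].
have : \forall n \near \oo, K `<=` Q n.
  apply: (compact_near_coveringP K).1 => // x Kx.
  have [e [M [e0 H]]] := C1_locally_bounded (KU _ Kx).
  have e2 : 0 < e / 2 by rewrite divr_gt0.
  exists (ball x (e / 2), [set n | M <= n%:R /\ n.+1%:R^-1 < e / 2]) => /=.
    split; first exact: nbhsx_ballx.
    apply: filterI; first exact: nbhs_infty_ger.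
    exact: (near_infty_natSinv_lt (PosNum e2)).
  move=> [z n] /= [xz [nM ne]] y zy.
  have xy : ball x e y.
    by rewrite [e]splitr; apply: (ball_triangle xz); apply: le_ball zy; exact: ltW.
  have [Uy fy py] := H y xy.
  by split=> // [|i]; exact: le_trans nM.
move=> [n _ /(_ n (leqnn n)) KQ].
exists n.+1%:R^-1, n%:R; split=> [|x y Kx]; first by rewrite invr_gt0.
exact: KQ.
Qed.
End C1_on_open_set.

End directional_derivatives.

(** * The depth as an integral over the unit lens *)

Section lens_depth.
Variables (R : realType) (p : nat).
Local Notation leb2 := (lebesgue_rV R p \x lebesgue_rV R p)%E.
Local Notation L := (lens 1%E (0 : 'rV[R]_p)).
Implicit Types (x mu : 'rV[R]_p) (f : 'rV[R]_p -> R).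

Definition pair_density f tau x (z : 'rV[R]_p * 'rV[R]_p) : R :=
  f (x + tau *: z.1) * f (x + tau *: z.2).

(** The [i]-th component of the vector integral of the main theorem.  When [f]
    has continuous partial derivatives around the closed ball, it is half of the
    [i]-th partial derivative of [x |-> int_L pair_density f tau x] at [mu]. *)
Definition lens_gradient f tau mu i : R := \int[leb2]_(z in L)
  (f (mu + tau *: z.2) * partial i f (mu + tau *: z.1)).

Lemma local_lens_depth_density (P : probability 'rV[R]_p R) f (tau : R) x :
  0 < tau -> is_density P f ->
  local_lens_depth P x tau%:E = tau ^+ p * tau ^+ p *
    \int[leb2]_(z in L) pair_density f tau x z.
Proof.
move=> tau0 [mf f0 Pf].
have mL : measurable (lens tau%:E x) by exact: measurable_lens.
pose phi (z : 'rV[R]_p * 'rV[R]_p) := (x + tau *: z.1, x + tau *: z.2).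
have mphi : measurable_fun setT phi by exact: measurable_affine_pair.
pose k := `|tau|^-1 ^+ p.
have k0 : 0 < k by rewrite exprn_gt0// invr_gt0 normr_gt0 gt_eqF.
have phik : scales_measure leb2 phi (k * k).
  by apply: scales_affine_pair; rewrite gt_eqF.
pose F (z : 'rV[R]_p * 'rV[R]_p) := (f z.1 * f z.2)%:E.
have mF : measurable_fun setT F.
  apply/measurable_EFinP; apply: measurable_funM.
    exact: (measurableT_comp mf measurable_fst).
  exact: (measurableT_comp mf measurable_snd).
have F0 z : (0 <= F z)%E by rewrite lee_fin mulr_ge0.
have kk0 : 0 < k * k by rewrite mulr_gt0.
have := @ge0_integral_scales _ _ _ leb2 phi (k * k) (lens tau%:E x) F kk0 phik
  mphi mL (measurable_funTS mF) (fun z _ => F0 z).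
rewrite /phi preimage_lens// -/phi => E.
transitivity (fine ((P \x P)%E (lens tau%:E x))).
  by rewrite /local_lens_depth /Rintegral integral_indic// setIT.
rewrite (product_density mf f0 Pf mL) -/F.
have -> : tau ^+ p * tau ^+ p = (k * k)^-1.
  by rewrite /k gtr0_norm// !exprVn -invfM invrK.
have -> : (\int[leb2]_(z in lens tau%:E x) F z)%E =
    ((k * k)^-1%:E * \int[leb2]_(z in L) F (phi z))%E.
  by rewrite E [RHS]muleA -EFinM mulVf ?gt_eqF// mul1e.
rewrite [X in _ = _ * fine X](_ : _ = (\int[leb2]_(z in L) F (phi z))%E)//.
(* [fine] commutes with the factor also when the integral is infinite. *)
have : (0 <= \int[leb2]_(z in L) F (phi z))%E by exact: integral_ge0.
case: (\int[leb2]_(z in L) F (phi z))%E => //= _.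
by rewrite gt0_muley ?mulr0// lte_fin invr_gt0.
Qed.

Lemma bounded_integrable_lens (g : 'rV[R]_p * 'rV[R]_p -> R) (M : R) :
  measurable_fun L g -> (forall z, L z -> `|g z| <= M) ->
  leb2.-integrable L (EFin \o g).
Proof.
move=> mg gM; apply: measurable_bounded_integrable => //.
- exact: measurable_lens.
- exact: lens_finite.
- exists M; split; first exact: num_real.
  by move=> M' MM' z Lz /=; exact: (le_trans (gM z Lz) (ltW MM')).
Qed.

(** * Differentiating the depth *)

Section C1_density.
Variables (f : 'rV[R]_p -> R) (tau : R) (mu : 'rV[R]_p).
Hypotheses (mf : measurable_fun setT f) (f_ge0 : forall x, 0 <= f x).
Hypothesis tau0 : 0 < tau.
Hypothesis fmu : 0 < f mu.
Variable U : set 'rV[R]_p.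
Hypotheses (oU : open U) (UB : eball tau mu `<=` U).
Hypothesis C1 : forall i x, U x ->
  has_partial i f x /\ {for x, continuous (partial i f)}.

Local Notation g := (pair_density f tau).
Local Notation J := (lens_gradient f tau mu).

Let mL : measurable L. Proof. exact: measurable_lens. Qed.

Let lens_eball z : L z ->
  eball tau mu (mu + tau *: z.1) /\ eball tau mu (mu + tau *: z.2).
Proof.
move=> /lens_sub_unit[z1 z2]; rewrite /eball/= ![mu + _]addrC !addrK !enormZ.
by rewrite gtr0_norm// -{2 4}[tau]mulr1 !ler_pM2l.
Qed.

Let measurable_f_affine x (h : 'rV[R]_p * 'rV[R]_p -> 'rV[R]_p) :
  measurable_fun setT h ->
  measurable_fun L (fun z => f (x + tau *: h z)).
Proof.
move=> mh; apply: measurable_funTS; apply: (measurableT_comp mf).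
exact: (measurableT_comp (measurable_affine_rV x tau) mh).
Qed.

Let measurable_partial_affine i (h : 'rV[R]_p * 'rV[R]_p -> 'rV[R]_p) :
  measurable_fun setT h ->
  (forall z, L z -> U (mu + tau *: h z)) ->
  measurable_fun L (fun z => partial i f (mu + tau *: h z)).
Proof.
move=> mh hU; apply: (@measurable_comp _ _ _ _ _ _ U (partial i f)) => //.
- exact: measurable_rV_open.
- by move=> _ [z Lz <-]; exact: hU.
- by apply: measurable_fun_continuous_rV => // x Ux; exact: (C1 i Ux).2.
- apply: measurable_funTS.
  exact: (measurableT_comp (measurable_affine_rV mu tau) mh).
Qed.

(** By continuity [f >= f mu / 2] near [mu], hence [g mu >= (f mu / 2)^2] on a
    small box inside [L], and this box has positive measure. *)
Lemma depth_integral_gt0 : leb2.-integrable L (EFin \o g mu) ->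
  0 < \int[leb2]_(z in L) g mu z.
Proof.
move=> ig.
have Umu : U mu.
  by apply: UB; rewrite /eball/= subrr -(scale0r 0) enormZ normr0 mul0r ltW.
have f20 : 0 < f mu / 2 by rewrite divr_gt0.
have [r r0 fr] := (continuous_rV_ballP _ _).1 (C1_continuous oU C1 Umu) _ f20.
(* The first bound on [s] keeps [mu + tau *: y] within [r / 2] of [mu], the
   second one puts the box inside [L]. *)
pose s := Num.min (r / (2 * tau)) (2 * p.+1%:R)^-1.
have s0 : 0 < s.
  by rewrite lt_min divr_gt0 ?mulr_gt0//= invr_gt0 mulr_gt0// ltr0n.
have BL : orthant_box s `<=` L.
  by apply: orthant_box_lens; rewrite // ge_min lexx orbT.
have fb (y : 'rV[R]_p) :
    (forall i, `|y ord0 i| <= s) -> f mu / 2 <= f (mu + tau *: y).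
  move=> ys; suff /fr : ball mu r (mu + tau *: y).
    by move=> /(le_lt_trans (ler_norm _)); lra.
  apply/ball_rVP => // i; rewrite !mxE opprD addrA subrr sub0r normrN normrM.
  rewrite gtr0_norm//.
  apply: (@le_lt_trans _ _ (tau * s)); first by rewrite ler_pM2l.
  apply: (@le_lt_trans _ _ (tau * (r / (2 * tau)))).
    by rewrite ler_pM2l// ge_min lexx.
  have -> : tau * (r / (2 * tau)) = r / 2 by field; rewrite gt_eqF.
  by rewrite ltr_pdivrMr//; lra.
apply: fine_gt0; rewrite integrable_lty// andbT.
apply: (@lt_le_trans _ _
    (\int[leb2]_(z in orthant_box s) ((f mu / 2) * (f mu / 2))%:E)%E).
  rewrite integral_cst; last exact: measurable_orthant_box.
  by apply: mule_gt0; [rewrite lte_fin mulr_gt0|exact: orthant_box_gt0].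
have mg : measurable_fun L (EFin \o g mu) by case/integrableP : ig.
apply: (@le_trans _ _ (\int[leb2]_(z in orthant_box s) (g mu z)%:E)%E).
  apply: ge0_le_integral => //.
  - exact: measurable_orthant_box.
  - by move=> z _; rewrite lee_fin mulr_ge0// ltW.
  - exact: measurable_funS mg.
  - move=> z Bz; rewrite lee_fin; have zs := orthant_box_coord Bz.
    by rewrite ler_pM ?(ltW f20)//; apply: fb => i;
      [exact: (zs i).1|exact: (zs i).2].
apply: ge0_subset_integral => //; first exact: measurable_orthant_box.
by move=> z _; rewrite lee_fin mulr_ge0.
Qed.

Let measurable_pair_density x : measurable_fun L (g x).
Proof. by apply: measurable_funM; exact: measurable_f_affine. Qed.

(** The uniform bounds that dominate the integrands for all [x] near [mu]. *)
Let near_ball_bounds : exists e M : R, 0 < e /\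
  forall x z, ball mu e x -> L z ->
   [/\ U (x + tau *: z.1), U (x + tau *: z.2),
       `|f (x + tau *: z.1)| <= M, `|f (x + tau *: z.2)| <= M &
       forall i, `|partial i f (x + tau *: z.1)| <= M /\
                 `|partial i f (x + tau *: z.2)| <= M].
Proof.
have [e [M [e0 H]]] :=
  C1_bounded_near_compact oU C1 (@eball_compact R p tau mu) UB.
exists e, M; split=> // x z mux /lens_eball[z1 z2].
have shift y : ball (mu + tau *: y) e (x + tau *: y).
  apply/ball_rVP => // i; rewrite !mxE opprD addrACA subrr addr0.
  exact: ((ball_rVP mu x e0).1 mux).
have [U1 f1 p1] := H _ _ z1 (shift z.1).
have [U2 f2 p2] := H _ _ z2 (shift z.2).
by split=> // i; split.
Qed.

Lemma depth_integrable : leb2.-integrable L (EFin \o g mu).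
Proof.
have [e [M [e0 H]]] := near_ball_bounds.
apply: (bounded_integrable_lens (M := M * M)) => // z Lz.
have [_ _ f1 f2 _] := H mu z (ballxx _ e0) Lz.
by rewrite normrM ler_pM.
Qed.

Lemma depth_partial_integrable i : leb2.-integrable L
  (EFin \o (fun z => f (mu + tau *: z.2) * partial i f (mu + tau *: z.1))).
Proof.
have [e [M [e0 H]]] := near_ball_bounds.
apply: (@bounded_integrable_lens _ (M * M)) => [|z Lz].
  apply: measurable_funM; first exact: measurable_f_affine.
  by apply: measurable_partial_affine => // z /lens_eball[z1 _]; exact: UB.
have [_ _ f1 f2 pf] := H mu z (ballxx _ e0) Lz.
by rewrite normrM ler_pM// (pf i).1.
Qed.

Let depth_partial_swap i :
  leb2.-integrable L
    (EFin \o (fun z => f (mu + tau *: z.1) * partial i f (mu + tau *: z.2))) /\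
  \int[leb2]_(z in L) (f (mu + tau *: z.1) * partial i f (mu + tau *: z.2)) = J i.
Proof.
have [e [M [e0 H]]] := near_ball_bounds.
pose h (z : 'rV[R]_p * 'rV[R]_p) :=
  f (mu + tau *: z.1) * partial i f (mu + tau *: z.2).
have mh : measurable_fun L h.
  apply: measurable_funM; first exact: measurable_f_affine.
  by apply: measurable_partial_affine => // z /lens_eball[_ z2]; exact: UB.
split.
  apply: (@bounded_integrable_lens h (M * M)) => // z Lz.
  have [_ _ f1 f2 pf] := H mu z (ballxx _ e0) Lz.
  by rewrite normrM ler_pM// (pf i).2.
pose sw (z : 'rV[R]_p * 'rV[R]_p) := (z.2, z.1).
have LE : sw @^-1` L = L.
  by apply/funext => z; apply/propext; exact: (lens_swap z).
have msw : measurable_fun setT sw by exact: measurable_swap.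
have ksw : scales_measure leb2 sw 1 by exact: scales_measure_swap.
symmetry.
exact: (Rintegral_preserving ksw msw mL mh LE (depth_partial_integrable i)).
Qed.

(** The two terms of the product rule have the same integral, because they are
    exchanged by [(z1, z2) -> (z2, z1)]; this is where the factor 2 comes
    from. *)
Lemma depth_integral_is_derive i :
  is_derive (0 : R) 1
    (fun h : R => \int[leb2]_(z in L) g (mu + h *: delta_mx ord0 i) z)
    (2 * J i).
Proof.
have [d [M [d0 H]]] := near_ball_bounds.
pose e : 'rV[R]_p := delta_mx ord0 i.
pose G (h : R) z := g (mu + h *: e) z.
have ballh (h : R) : `]-d, d[%classic h -> ball mu d (mu + h *: e).
  rewrite /= in_itv/= -ltr_norml => hd; apply/ball_rVP => // j.
  rewrite !mxE eqxx/=.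
  rewrite opprD addrA subrr sub0r normrN normrM (le_lt_trans _ hd)//.
  by case: (j == i); rewrite ?normr1 ?mulr1 ?normr0 ?mulr0.
have dfac (y : 'rV[R]_p) (h : R) : U (mu + h *: e + tau *: y) ->
    is_derive h 1 (fun t : R => f (mu + t *: e + tau *: y))
      (partial i f (mu + h *: e + tau *: y)).
  move=> Uy.
  have E (t : R) : mu + t *: e + tau *: y = (mu + tau *: y) + t *: e.
    by rewrite addrAC.
  rewrite (_ : (fun t : R => _) =
    (fun t : R => f ((mu + tau *: y) + t *: e))); last first.
    by apply/funext => t; rewrite E.
  rewrite E; apply: DeriveDef; last by rewrite derive_line.
  by apply/derivable_line; rewrite -E; exact: (C1 i Uy).1.
pose dG (h : R) z :=
  f (mu + h *: e + tau *: z.1) * partial i f (mu + h *: e + tau *: z.2) +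
  f (mu + h *: e + tau *: z.2) * partial i f (mu + h *: e + tau *: z.1).
have GdG h z : `]-d, d[%classic h -> L z -> is_derive h 1 (G ^~ z) (dG h z).
  move=> hd Lz; have [U1 U2 _ _ _] := H _ z (ballh h hd) Lz.
  exact: (is_deriveM (dfac _ _ U1) (dfac _ _ U2)).
have G1E h z : `]-d, d[%classic h -> L z -> partial1of2 G h z = dG h z.
  by move=> hd Lz; rewrite partial1of2E; have [_ ->] := GdG h z hd Lz.
have I0 : `]-d, d[%classic (0 : R) by rewrite /= in_itv/= oppr_lt0 d0.
have intG h : `]-d, d[%classic h -> leb2.-integrable L (EFin \o G h).
  move=> hd; apply: (@bounded_integrable_lens _ (M * M)) => [|z Lz].
    exact: measurable_pair_density.
  have [_ _ f1 f2 _] := H _ z (ballh h hd) Lz.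
  by rewrite normrM ler_pM.
have derG h z : `]-d, d[%classic h -> L z -> derivable (G ^~ z) h 1.
  by move=> hd Lz; have [] := GdG h z hd Lz.
have M0 : 0 <= M * M + M * M by rewrite addr_ge0// -expr2 sqr_ge0.
have intM : leb2.-integrable L (EFin \o (fun=> M * M + M * M)).
  apply: (@bounded_integrable_lens _ (M * M + M * M)) => // z _.
  by rewrite ger0_norm.
have G1M h z : `]-d, d[%classic h -> L z ->
    `|partial1of2 G h z| <= M * M + M * M.
  move=> hd Lz; rewrite G1E//; have [_ _ f1 f2 pf] := H _ z (ballh h hd) Lz.
  rewrite (le_trans (ler_normD _ _))// lerD// normrM ler_pM//.
    exact: (pf i).2.
  exact: (pf i).1.
have D1 := derivable_under_integral mL I0 intG derG (fun=> M0) intM G1M.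
have D2 := differentiation_under_integral mL I0 intG derG (fun=> M0) intM G1M.
apply: DeriveDef => //.
rewrite -derive1E [LHS]D2.
have -> : \int[leb2]_(z in L) partial1of2 G 0 z =
  \int[leb2]_(z in L) (f (mu + tau *: z.1) * partial i f (mu + tau *: z.2) +
     f (mu + tau *: z.2) * partial i f (mu + tau *: z.1)).
  by apply: eq_Rintegral => z /[!inE] Lz; rewrite G1E// /dG scale0r addr0.
have [i1 i1E] := depth_partial_swap i.
rewrite (RintegralD mL i1 (depth_partial_integrable i)) i1E.
by rewrite mulr_natl mulr2n.
Qed.

(** In the interior of the ball the identity [f (mu + x) = f (mu - x)] holds near
    the given point and can be differentiated.  On the boundary sphere it only
    holds on one side, and the claim follows by continuity of the partial
    derivative. *)
Lemma centrally_symmetric_partial_odd i : centrally_symmetric tau mu f ->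
  forall u, enorm u <= tau -> partial i f (mu - u) = - partial i f (mu + u).
Proof.
move=> fsym.
pose e : 'rV[R]_p := delta_mx ord0 i.
have enorm_cont (u : 'rV[R]_p) : enorm u < tau ->
    \forall t \near (0 : R), enorm (u + t *: e) < tau.
  move=> utau.
  have c : {for 0, continuous (fun t : R => enorm (u + t *: e))}.
    apply: (@continuous_comp _ _ _ (fun t : R => u + t *: e) (@enorm R p)).
      apply: (@continuousD _ _ _ (cst u) (fun t : R => t *: e)).
        exact: cst_continuous.
      exact: scalel_continuous.
    exact: continuous_enorm.
  by apply: (cvgr_lt _ c); rewrite scale0r addr0.
have odd_in (u : 'rV[R]_p) : enorm u < tau ->
    partial i f (mu - u) = - partial i f (mu + u).
  move=> utau.
  have inU (v : 'rV[R]_p) : enorm v < tau -> U (mu + v).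
    by move=> vtau; apply: UB; rewrite /eball/= addrAC subrr add0r ltW.
  have E1 := derive_line f (mu + u) e 0.
  have E2 := derive_line f (mu - u) e 0.
  rewrite !scale0r !addr0 in E1 E2; rewrite /partial -/e -E1 -E2.
  have -> : 'D_1 (fun t : R => f (mu + u + t *: e)) 0 =
      'D_1 ((fun t : R => f (mu - u + t *: e)) \o -%R) 0.
    apply: near_eq_derive; near=> t.
    rewrite /= scaleNr -!addrA fsym; last first.
      by apply: ltW; near: t; exact: enorm_cont.
    by rewrite opprD.
  have dfu : derivable (fun t : R => f (mu - u + t *: e)) 0 1.
    apply/derivable_line; rewrite scale0r addr0.
    by apply: (C1 i _).1; apply: inU; rewrite enormN.
  have dN : is_derive (0 : R) 1 (-%R : R -> R) (-1).
    exact: (is_deriveN (is_derive_id (0 : R) 1)).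
  have dfu0 : is_derive (- 0 : R) 1 (fun t : R => f (mu - u + t *: e))
      ('D_1 (fun t : R => f (mu - u + t *: e)) 0).
    by rewrite oppr0; exact/DeriveDef.
  have [_ ->] := is_derive1_comp dfu0 dN.
  by rewrite mulrN1 opprK.
(* A point of the sphere is the limit of [t *: u] as [t] tends to 1 from below.
   If [h 1] were nonzero, then [h t] would be too for some [t < 1] close to 1. *)
move=> u utau; apply/eqP; rewrite -addr_eq0; apply/eqP; apply: contrapT => neq0.
pose h (t : R) := partial i f (mu + t *: - u) + partial i f (mu + t *: u).
have lineC (v : 'rV[R]_p) : enorm v <= tau ->
    {for 1, continuous (fun t : R => partial i f (mu + t *: v))}.
  move=> vtau.
  apply: (@continuous_comp _ _ _ (fun t : R => mu + t *: v) (partial i f)).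
    apply: (@continuousD _ _ _ (cst mu) (fun t : R => t *: v)).
      exact: cst_continuous.
    exact: scalel_continuous.
  apply: (C1 i _).2; apply: UB.
  by rewrite /eball/= scale1r addrAC subrr add0r.
have hC : {for 1, continuous h}.
  by apply: continuousD; apply: lineC; rewrite ?enormN.
have h1 : 0 < `|h 1| by rewrite normr_gt0 /h !scale1r; apply/eqP.
have /cvgrPdist_lt/(_ _ h1)/nbhs_ballP[d /= d0 hd] := hC.
pose t := 1 - Num.min (d / 2) 2^-1.
have m0 : 0 < Num.min (d / 2) 2^-1 by rewrite lt_min divr_gt0/= ?invr_gt0.
have md : Num.min (d / 2) 2^-1 <= d / 2 by rewrite ge_min lexx.
have m1 : Num.min (d / 2) 2^-1 <= 2^-1 by rewrite ge_min lexx orbT.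
have /hd : ball (1 : R) d t.
  by rewrite /ball/= /t opprB addrC subrK gtr0_norm//; lra.
suff -> : h t = 0 by rewrite subr0 ltxx.
have ttau : enorm (t *: u) < tau.
  have t0 : 0 < t by rewrite /t; lra.
  have [u0|u0] := leP (enorm u) 0.
    by rewrite enormZ (le_lt_trans _ tau0)// mulr_ge0_le0.
  rewrite enormZ gtr0_norm//; apply: lt_le_trans utau.
  by rewrite gtr_pMl// /t; lra.
by rewrite /h scalerN odd_in// addNr.
Unshelve. all: by end_near. Qed.

(** The integrand changes sign under the reflection [z -> - z], which preserves
    [L] and the measure. *)
Lemma lens_gradient_centrally_symmetric i :
  centrally_symmetric tau mu f -> J i = 0.
Proof.
move=> fsym.
pose G (z : 'rV[R]_p * 'rV[R]_p) :=
  f (mu + tau *: z.2) * partial i f (mu + tau *: z.1).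
pose N (z : 'rV[R]_p * 'rV[R]_p) := (0 + -1 *: z.1, 0 + -1 *: z.2).
have mN : measurable_fun setT N by exact: measurable_affine_pair.
have NE z : N z = (- z.1, - z.2) by rewrite /N !add0r !scaleN1r.
have kN : scales_measure leb2 N 1.
  have N1 : (-1 : R) != 0 by rewrite oppr_eq0 oner_eq0.
  have := scales_affine_pair (0 : 'rV[R]_p) N1.
  by rewrite normrN1 invr1 expr1n mulr1.
have LN : N @^-1` L = L.
  apply/funext => z; apply/propext; rewrite /preimage/= NE.
  exact: (lens_opp z).
have mG : measurable_fun L G.
  apply: measurable_funM; first exact: measurable_f_affine.
  by apply: measurable_partial_affine => // z /lens_eball[z1 _]; exact: UB.
have GN z : L z -> G (N z) = -1 * G z.
  move=> Lz; rewrite NE /G/= !scalerN.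
  have [z1 z2] := lens_sub_unit Lz.
  have scaled (y : 'rV[R]_p) : enorm y <= 1 -> enorm (tau *: y) <= tau.
    by move=> y1; rewrite enormZ gtr0_norm// -[leRHS]mulr1 ler_pM2l.
  rewrite (centrally_symmetric_partial_odd _ fsym) ?scaled//.
  by rewrite -fsym ?scaled// mulrN mulN1r.
have iG : leb2.-integrable L (EFin \o G) by exact: depth_partial_integrable.
have iGN : leb2.-integrable L (EFin \o (G \o N)).
  have [e' [M [e0 H]]] := near_ball_bounds.
  have mGN : measurable_fun L (G \o N).
    apply: (@measurable_comp _ _ _ _ _ _ L G) => //.
      by move=> _ [z Lz <-]; rewrite -LN /preimage/= in Lz.
    exact: measurable_funTS.
  apply: (@bounded_integrable_lens _ (M * M)) => // z Lz.
  rewrite /= GN// mulN1r normrN.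
  have [_ _ f1 f2 pf] := H mu z (ballxx _ e0) Lz.
  by rewrite normrM ler_pM// (pf i).1.
have JE : J i = -1 * J i.
  transitivity (\int[leb2]_(z in L) G (N z)).
    exact/esym/(Rintegral_preserving kN mN mL mG LN iGN).
  rewrite -(RintegralZl _ mL iG).
  by apply: eq_Rintegral => z /[!inE]; exact: GN.
lra.
Qed.

Lemma lens_volume_gt0 : 0 < lens_volume R p.
Proof.
pose s : R := (2 * p.+1%:R)^-1.
have s0 : 0 < s by rewrite invr_gt0 mulr_gt0// ltr0n.
apply: fine_gt0; rewrite lens_finite andbT.
apply: (lt_le_trans (orthant_box_gt0 p s0)); apply: le_measure; rewrite ?inE.
- exact: measurable_orthant_box.
- exact: measurable_lens.
- exact: orthant_box_lens.
Qed.

(** [f_tau P tau x] is [C * sqrt (K * F x)] with constants [C, K > 0], where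
    [F x] is the integral of [pair_density f tau x] over [L]; the chain rule
    applies because [F mu > 0]. *)
Lemma partial_f_tau (P : probability 'rV[R]_p R) : is_density P f ->
  exists2 kappa : R, 0 < kappa & forall i,
    has_partial i (f_tau P tau) mu /\ partial i (f_tau P tau) mu = kappa * J i.
Proof.
move=> Pf.
pose F0 := \int[leb2]_(z in L) g mu z.
have F00 : 0 < F0 by apply: depth_integral_gt0; exact: depth_integrable.
pose K := tau ^+ p * tau ^+ p.
have K0 : 0 < K by rewrite mulr_gt0// exprn_gt0.
pose C := (tau ^+ p * Num.sqrt (lens_volume R p))^-1.
have C0 : 0 < C.
  by rewrite invr_gt0 mulr_gt0 ?exprn_gt0// sqrtr_gt0 lens_volume_gt0.
have KF0 : 0 < K * F0 by rewrite mulr_gt0.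
have S0 : 0 < 2 * Num.sqrt (K * F0) by rewrite mulr_gt0// sqrtr_gt0.
exists (C * ((2 * Num.sqrt (K * F0))^-1 * (K * 2))).
  by rewrite mulr_gt0// mulr_gt0 ?invr_gt0// mulr_gt0.
move=> i; pose e : 'rV[R]_p := delta_mx ord0 i.
pose F (h : R) := \int[leb2]_(z in L) g (mu + h *: e) z.
have FE : F 0 = F0 by rewrite /F scale0r addr0.
have dF := depth_integral_is_derive i; rewrite -/(F) in dF.
have dKF : is_derive (0 : R) 1 (K *: F) (K *: (2 * J i)) by exact: is_deriveZ.
have dsqrt : is_derive ((K *: F) 0) 1 Num.sqrt (2 * Num.sqrt (K * F0))^-1.
  rewrite (_ : (K *: F) 0 = K * F0); first exact: is_derive1_sqrt.
  by rewrite -FE.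
have E : (fun h : R => f_tau P tau (mu + h *: e)) = C *: (Num.sqrt \o (K *: F)).
  by apply/funext => h; rewrite /f_tau (local_lens_depth_density _ _ Pf).
have [D1 D2] : is_derive (0 : R) 1 (fun h : R => f_tau P tau (mu + h *: e))
    (C *: ((2 * Num.sqrt (K * F0))^-1 * (K *: (2 * J i)))).
  by rewrite E; apply: is_deriveZ; exact: is_derive1_comp.
split.
  by move/derivable_line : D1; rewrite scale0r addr0.
move: D2; rewrite derive_line scale0r addr0 /partial => ->.
by rewrite /GRing.scale/=; ring.
Qed.

End C1_density.
End lens_depth.

Theorem theorem3p3 (R : realType) (p : nat) (hp : (1 <= p)%N)
    (P : probability 'rV[R]_p R) (P_ac : P `<< lebesgue_rV R p)
    (f : 'rV[R]_p -> R) (f_density : is_density P f)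
    (tau : R) (tau_gt0 : 0 < tau)
    (mu : 'rV[R]_p) (mu_S : positivity_set f mu)
    (f_C1 : continuous_partials_on (eball tau mu) f) :
  (stationary_point (f_tau P tau) mu <->
   vec_integral (lebesgue_rV R p \x lebesgue_rV R p)%E (lens 1%E 0)
     (fun z => f (mu + tau *: z.2) *: grad f (mu + tau *: z.1)) = 0) /\
  (centrally_symmetric tau mu f ->
   stationary_point (f_tau P tau) mu).
Proof.
have [mf f0 _] := f_density; have [U [oU UB C1]] := f_C1.
have [kappa kappa0 dftau] :=
  partial_f_tau mf f0 tau_gt0 mu_S oU UB C1 f_density.
have stationaryP : stationary_point (f_tau P tau) mu <->
    forall i, lens_gradient f tau mu i = 0.
  split=> [[_ grad0] i|J0].
    have := congr1 (fun v : 'rV[R]_p => v ord0 i) grad0; rewrite !mxE.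
    by rewrite (dftau i).2 => /eqP; rewrite mulf_eq0 gt_eqF//= => /eqP.
  split=> [i|]; first exact: (dftau i).1.
  by apply/rowP => i; rewrite !mxE (dftau i).2 J0 mulr0.
split.
  rewrite stationaryP.
  have E i : vec_integral (lebesgue_rV R p \x lebesgue_rV R p)%E (lens 1%E 0)
     (fun z => f (mu + tau *: z.2) *: grad f (mu + tau *: z.1)) ord0 i =
     lens_gradient f tau mu i.
    by rewrite mxE; apply: eq_Rintegral => z _; rewrite !mxE.
  split=> [J0|V0 i]; last by rewrite -E V0 mxE.
  by apply/rowP => i; rewrite E J0 mxE.
move=> fsym; apply/stationaryP => i.
exact: (lens_gradient_centrally_symmetric mf tau_gt0 oU UB C1 i fsym).
Qed.
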